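(* Let $k\ge 2$ and $n$ be integers with $n\ge e^{k2^{k+2}}$. Then $$\left|B_k(n)-D_k\,g_k(n)\,\frac{n^{k-1}}{(k-1)!}\right|\le \frac{707\,n^{k-1}}{\log n}.$$
   Context: $\mathbb{N}$ denotes the positive integers, $p$ always denotes a prime, and $\log$ is the natural logarithm. For positive integers $k,n$ with $k\ge 2$: $B_k(n)$ is the number of tuples $(x_1,\dots,x_k)\in\mathbb{N}^{k}$ with $n=x_1+\cdots+x_k$ and $\gcd(x_i,x_j)=1$ for all $1\le i<j\le k$. $\delta_k(x)=\dfrac{(x-1)^{k}+k(x-1)^{k-1}+(-1)^{k}(k-1)}{x}$. $D_k=\prod_{p}\dfrac{\delta_k(p)}{p^{k-1}}$, the product being over all primes $p$. $g_k(n)=\prod_{p\mid n}\left(1+\dfrac{(-1)^{k-1}(k-1)}{\delta_k(p)}\right)$, the product being over the primes $p$ dividing $n$. *)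

(* Defs.v *)
From HB Require Import structures.
From mathcomp Require Import all_boot all_order all_algebra.
From mathcomp Require Import all_classical all_reals all_analysis.

Set Implicit Arguments.
Unset Strict Implicit.
Unset Printing Implicit Defensive.

Import Order.TTheory GRing.Theory Num.Theory.
Import numFieldNormedType.Exports.

Local Open Scope ring_scope.

(* The summands are positive and add up to n, so each of them is at most n and
   the entries can be taken in 'I_n.+1. *)
Definition B (k n : nat) : nat :=
  #|[set x : {ffun 'I_k -> 'I_n.+1} |
      [&& [forall i : 'I_k, (0 < x i)%N],
          (\sum_i (x i : nat))%N == n
        & [forall i : 'I_k, forall j : 'I_k, (i < j)%N ==> coprime (x i) (x j)]]]|.

Definition delta (R : realType) (k : nat) (x : R) : R :=
  ((x - 1) ^+ k + k%:R * (x - 1) ^+ k.-1 + (-1) ^+ k * (k%:R - 1)) / x.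

(* The infinite product over all primes is the limit of the products over the
   primes below N; for k >= 2 every factor lies in ]0, 1], so this limit
   exists. *)
Definition D (R : realType) (k : nat) : R :=
  limn (fun N : nat =>
    \prod_(0 <= p < N | prime p) (delta k (p%:R : R) / p%:R ^+ k.-1)).

(* For n > 0, primes n lists the primes dividing n, without repetition. *)
Definition g (R : realType) (k n : nat) : R :=
  \prod_(p <- primes n) (1 + (-1) ^+ k.-1 * (k%:R - 1) / delta k (p%:R : R)).

(* Main.v *)
(* For k = 2 both sides agree: B_2(n) = phi(n), D_2 = 1 and g_2(n) n = phi(n).
   For k >= 3, choose y = 2^j with 16^y <= n < 16^(2y), so that log n <= 8y, and
   let P be the product of the primes p <= y; since the primes in ]m, 2m] divide
   C(2m, m) <= 4^m, induction on j gives P <= 4^y <= sqrt n.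
   - Tuples with sum n in which no prime p <= y divides two entries: split them
     by their residues mod P.  By the Chinese remainder theorem the number of
     admissible residue tuples is P^(k-1) times the product over p <= y of the
     local densities of D_k g_k(n), and each residue class contains
     C(M + k - 1, k - 1) tuples with M = n/P + O(k).
   - Tuples in which some p > y divides two entries: for a given pair of entries
     there are at most (n/p)^2 n^(k-3)/(k-3)! of them, and the sum of p^-2 over
     p > y is at most 1/y.
   - The local densities at p > y differ from 1 by at most k^2/p^2, so dropping
     them from D_k g_k(n) costs at most k^2/y.
   Since k^2 <= 16 (k-3)!, these errors add up to at most
   64 n^(k-1)/y <= 512 n^(k-1)/log n. *)

Require Import Defs.
From HB Require Import structures.
From mathcomp Require Import all_boot all_order all_algebra.
From mathcomp Require Import all_classical all_reals all_analysis.
From mathcomp Require Import zify ring lra.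

Set Implicit Arguments.
Unset Strict Implicit.
Unset Printing Implicit Defensive.

Import Order.TTheory GRing.Theory Num.Theory.
Import numFieldNormedType.Exports.

Local Open Scope ring_scope.

(** * Compositions of an integer *)

Local Open Scope nat_scope.

(** The position [i] is arbitrary, so that any two chosen entries can be summed out. *)
Definition ffun_insert k (T : finType) (i : 'I_k.+1) (x : T) (f : {ffun 'I_k -> T}) :
    {ffun 'I_k.+1 -> T} :=
  [ffun l => if unlift i l is Some l' then f l' else x].

Lemma ffun_insert_at k (T : finType) (i : 'I_k.+1) (x : T) (f : {ffun 'I_k -> T}) :
  ffun_insert i x f i = x.
Proof. by rewrite ffunE unlift_none. Qed.

Lemma ffun_insert_lift k (T : finType) (i : 'I_k.+1) (x : T) (f : {ffun 'I_k -> T}) l :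
  ffun_insert i x f (lift i l) = f l.
Proof. by rewrite ffunE liftK. Qed.

Lemma sum_ffun_insert k (T : finType) (i : 'I_k.+1) (F : {ffun 'I_k.+1 -> T} -> nat) :
  \sum_f F f = \sum_(x : T) \sum_(f : {ffun 'I_k -> T}) F (ffun_insert i x f).
Proof.
rewrite pair_big; apply: (reindex (fun u => ffun_insert i u.1 u.2)).
exists (fun f : {ffun 'I_k.+1 -> T} => (f i, [ffun l => f (lift i l)])).
  move=> [x f] _ /=; rewrite ffun_insert_at; congr (_, _).
  by apply/ffunP=> l; rewrite ffunE ffun_insert_lift.
move=> f _; apply/ffunP=> l /=; rewrite ffunE.
by case: unliftP => [l' ->|->]; rewrite ?ffunE.
Qed.

Lemma sum_ffun_insert_ord k (T : finType) (i : 'I_k.+1) (x : T) (f : {ffun 'I_k -> T})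
    (G : T -> nat) :
  \sum_l G (ffun_insert i x f l) = G x + \sum_l G (f l).
Proof.
rewrite (bigD1_ord i) //= ffun_insert_at; congr (_ + _).
by apply: eq_bigr => l _; rewrite ffun_insert_lift.
Qed.

(** The hockey-stick identity, from Pascal's rule. *)
Lemma sum_bin_upper s k : \sum_(x < s.+1) 'C(s - x + k, k) = 'C(s + k.+1, k.+1).
Proof.
elim: s => [|s IH]; first by rewrite big_ord1 !add0n !binn.
rewrite big_ord_recl subn0 (eq_bigr (fun x : 'I_s.+1 => 'C(s - x + k, k))) => [|x _].
  by rewrite IH addnS -addSnnS [s.+2 + k]addSn binS addnC addSn.
by rewrite lift0 subSS.
Qed.

(** Stars and bars: the first entry is summed out and the hockey-stick identity applied. As [s < N],
    the bound on the entries excludes no composition. *)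
Lemma sum_compositions k N s : s < N ->
  \sum_(f : {ffun 'I_k.+1 -> 'I_N}) (\sum_i f i == s) = 'C(s + k, k).
Proof.
elim: k s => [|k IH] s lt_sN.
  rewrite addn0 bin0 (sum_ffun_insert ord0) (bigD1 (Ordinal lt_sN)) //= [X in _ + X]big1.
    rewrite addn0 (eq_bigr (fun=> 1)); last first.
      move=> f _; rewrite (sum_ffun_insert_ord _ _ _ (fun x : 'I_N => x : nat)) big_ord0.
      by rewrite addn0 eqxx.
    by rewrite sum1_card card_ffun !card_ord expn0.
  move=> x nx; apply: big1 => f _.
  rewrite (sum_ffun_insert_ord _ _ _ (fun x : 'I_N => x : nat)) big_ord0 addn0.
  by apply/eqP; rewrite eqb0; apply: contra nx => /eqP h; apply/eqP/val_inj.
rewrite (sum_ffun_insert ord0) -sum_bin_upper.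
transitivity (\sum_(x < N) if (x : nat) < s.+1 then 'C(s - x + k, k) else 0).
  apply: eq_bigr => x _.
  under eq_bigr => f _ do rewrite (sum_ffun_insert_ord _ _ _ (fun x : 'I_N => x : nat)).
  case: ltnP => lt_xs.
    rewrite -IH ?(leq_ltn_trans (leq_subr _ _)) //; apply: eq_bigr => f _.
    by congr nat_of_bool; set t := (\sum_i f i)%N; lia.
  by apply: big1 => f _; apply/eqP; rewrite eqb0; lia.
rewrite -big_mkcond /= (big_ord_widen_cond N (fun=> true) (fun x => 'C(s - x + k, k))) //.
Qed.

(** The falling factorial is k! times the binomial coefficient counting compositions, which is thus
    bracketed between [k]-th powers. *)
Lemma ffact_bounds s k : (s.+1 ^ k <= (s + k) ^_ k) && ((s + k) ^_ k <= (s + k) ^ k).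
Proof.
apply/andP; split.
  elim: k => [|k IH]; first by rewrite ffactn0.
  by rewrite addnS ffactnS /= expnS leq_mul // ltnS leq_addr.
have: forall m, m ^_ k <= m ^ k.
  elim: k => [|k IH] m; first by rewrite ffactn0.
  rewrite ffactnS expnS leq_mul // (leq_trans (IH _)) //.
  by case: k {IH} => // k; rewrite leq_exp2r // leq_pred.
exact.
Qed.

(** * Splitting by residues *)

(* Entries are stored decreased by one: x in 'I_n stands for the positive
   integer x.+1. [good m x] says that no prime factor of m divides two entries. *)
Definition good k m (x : 'I_k -> nat) : bool :=
  [forall i, forall j, (i != j) ==> coprime m (gcdn (x i).+1 (x j).+1)].

Lemma goodP k m (x : 'I_k -> nat) :
  reflect (forall i j, i != j -> coprime m (gcdn (x i).+1 (x j).+1)) (good m x).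
Proof.
apply: (iffP forallP) => [h i j ij|h i]; first by have /forallP/(_ j)/implyP := h i; apply.
by apply/forallP => j; apply/implyP; apply: h.
Qed.

Lemma gcdn_congr m a b : a = b %[mod m] -> gcdn m a = gcdn m b.
Proof. by move=> e; rewrite -gcdn_modr e gcdn_modr. Qed.

(** A gcd with [m] depends only on the other argument modulo [m], so [good m] is a property of
    residues. *)
Lemma good_congr k m (x y : 'I_k -> nat) :
  (forall i, x i = y i %[mod m]) -> good m x = good m y.
Proof.
move=> e; have eS i : gcdn m (x i).+1 = gcdn m (y i).+1.
  by apply: gcdn_congr; apply/eqP; rewrite -[(x i).+1]addn1 -[(y i).+1]addn1 eqn_modDr e.
apply: eq_forallb => i; apply: eq_forallb => j; congr (_ ==> _).
rewrite /coprime gcdnA (eS i) -gcdnA gcdnCA (eS j).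
by rewrite gcdnCA.
Qed.

Lemma good_mul k m p (x : 'I_k -> nat) : good (m * p) x = good m x && good p x.
Proof.
apply/goodP/andP => [h|[/goodP h1 /goodP h2] i j ij].
  by split; apply/goodP => i j ij; have := h i j ij; rewrite coprimeMl => /andP[].
by rewrite coprimeMl h1 ?h2.
Qed.

Lemma sum_succ_congr k m (x y : 'I_k -> nat) :
  (forall i, x i = y i %[mod m]) -> \sum_i (x i).+1 = \sum_i (y i).+1 %[mod m].
Proof.
move=> e; apply: (big_ind2 (fun a b => a = b %[mod m])) => // [a b c d ab cd|i _].
  by rewrite -modnDm ab cd modnDm.
by apply/eqP; rewrite -[(x i).+1]addn1 -[(y i).+1]addn1 eqn_modDr e.
Qed.

Definition nres k m s : nat :=
  \sum_(r : {ffun 'I_k -> 'I_m}) ((\sum_i (r i).+1 == s %[mod m]) && good m (fun i => r i)).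

(** Chinese remainder theorem in each coordinate; both conditions split over the coprime factors. *)
Lemma nres_mul k m p s : 0 < m -> 0 < p -> coprime m p ->
  nres k (m * p) s = nres k m s * nres k p s.
Proof.
move=> m0 p0 co; have mp0 : 0 < m * p by rewrite muln_gt0 m0.
rewrite /nres big_distrlr /= pair_big /=.
pose red d (d0 : 0 < d) (x : {ffun 'I_k -> 'I_(m * p)}) : {ffun 'I_k -> 'I_d} :=
  [ffun i => Ordinal (ltn_pmod (x i) d0)].
pose crt (u : {ffun 'I_k -> 'I_m} * {ffun 'I_k -> 'I_p}) : {ffun 'I_k -> 'I_(m * p)} :=
  [ffun i => Ordinal (ltn_pmod (chinese m p (u.1 i) (u.2 i)) mp0)].
rewrite (reindex (fun x => (red m m0 x, red p p0 x))) /=; last first.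
  exists crt => [x _|[u v] _].
    apply/ffunP=> i; apply/val_inj; rewrite !ffunE /=.
    by rewrite -chinese_mod // modn_small.
  congr (_, _); apply/ffunP=> i; apply/val_inj; rewrite !ffunE /=.
    by rewrite modn_dvdm ?dvdn_mulr // chinese_modl // modn_small.
  by rewrite modn_dvdm ?dvdn_mull // chinese_modr // modn_small.
apply: eq_bigr => x _; rewrite mulnb; congr nat_of_bool.
have em i : (red m m0 x i : nat) = x i %[mod m] by rewrite ffunE /= modn_mod.
have ep i : (red p p0 x i : nat) = x i %[mod p] by rewrite ffunE /= modn_mod.
rewrite (good_congr em) (good_congr ep) (sum_succ_congr em) (sum_succ_congr ep).
by rewrite chinese_remainder // good_mul andbACA.
Qed.

Definition nsieve k m n : nat :=
  \sum_(x : {ffun 'I_k -> 'I_n}) ((\sum_i (x i).+1 == n) && good m (fun i => x i)).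

(** Writing each entry as [P * m i + r i] turns the condition on the sum into: the [m i] add up to
    [M]. *)
Lemma sum_residue_class k P n (r : {ffun 'I_k.+1 -> 'I_P}) M :
  P * M + \sum_i (r i).+1 = n ->
  \sum_(x : {ffun 'I_k.+1 -> 'I_n})
    ((\sum_i (x i).+1 == n) && [forall i, x i %% P == r i]) = 'C(M + k, k).
Proof.
(* A sum of positive terms is not 0; the successor form is what [inord] requires. *)
case: n => [|n] defn; first by move: defn; rewrite big_ord_recl; lia.
have P0 : 0 < P by apply: leq_ltn_trans (ltn_ord (r ord0)).
have ltM : M < n.+1 by rewrite -defn big_ord_recl; nia.
rewrite -(sum_compositions k ltM) -big_mkcond -[RHS]big_mkcond /=.
pose lft (m : {ffun 'I_k.+1 -> 'I_n.+1}) : {ffun 'I_k.+1 -> 'I_n.+1} :=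
  [ffun i => inord (P * m i + r i)].
pose quo (x : {ffun 'I_k.+1 -> 'I_n.+1}) : {ffun 'I_k.+1 -> 'I_n.+1} :=
  [ffun i => inord (x i %/ P)].
have quoE x i : quo x i = x i %/ P :> nat.
  by rewrite ffunE inordK // ltnS (leq_trans (leq_div _ _)) // -ltnS.
rewrite (reindex_onto lft quo) /=; last first.
  move=> x /andP[_ /forallP rx]; apply/ffunP => i; apply/val_inj.
  by rewrite [LHS]/= [lft _]/lft ffunE quoE -(eqP (rx i)) mulnC -divn_eq inord_val.
apply: eq_bigl => m; apply/andP/eqP => [[/andP[/eqP sx /forallP rx] /eqP mE]|sm].
  apply/eqP; rewrite -(eqn_pmul2l P0) -(eqn_add2r (\sum_i (r i).+1)).
  apply/eqP; rewrite [RHS]defn -[RHS]sx big_distrr -big_split /=; apply: eq_bigr => i _.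
  by rewrite -{1}mE quoE -(eqP (rx i)) addnS mulnC -divn_eq.
have sE : \sum_i (P * m i + r i).+1 = n.+1.
  rewrite -[RHS]defn -sm big_distrr -big_split /=.
  by apply: eq_bigr => i _; rewrite addnS.
have lE i : lft m i = P * m i + r i :> nat.
  by rewrite ffunE inordK // -[X in _ <= X]sE (bigD1 i) //= leq_addr.
split; last first.
  apply/eqP/ffunP => i; apply/val_inj.
  by rewrite [LHS]/= quoE lE mulnC divnMDl // divn_small ?addn0.
apply/andP; split; last by apply/forallP => i; rewrite lE mulnC modnMDl modn_small.
by apply/eqP; rewrite -[RHS]sE; apply: eq_bigr => i _; rewrite lE.
Qed.

(** The hypothesis [k.+1 * P <= n] keeps the residue sum at most [n], so the subtraction is
    exact. *)
Lemma nsieve_residue_classes k P n : 0 < P -> k.+1 * P <= n ->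
  nsieve k.+1 P n =
  \sum_(r : {ffun 'I_k.+1 -> 'I_P})
    ((\sum_i (r i).+1 == n %[mod P]) && good P (fun i => r i))
      * 'C((n - \sum_i (r i).+1) %/ P + k, k).
Proof.
move=> P0 le_kPn; rewrite /nsieve.
pose red (x : {ffun 'I_k.+1 -> 'I_n}) : {ffun 'I_k.+1 -> 'I_P} :=
  [ffun i => Ordinal (ltn_pmod (x i) P0)].
rewrite (partition_big red xpredT) //=; apply: eq_bigr => r _.
have fE x : (red x == r) = [forall i, x i %% P == r i].
  apply/eqP/forallP => [<- i|h]; first by rewrite ffunE.
  by apply/ffunP => i; apply/val_inj; rewrite ffunE; apply/eqP/h.
have le_rn : \sum_i (r i).+1 <= n.
  apply: leq_trans le_kPn; rewrite -[k.+1 in X in _ <= X]card_ord -sum_nat_const.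
  exact: leq_sum.
case: (boolP (_ && _)) => [/andP[/eqP sr gr]|nr].
  have dv : P %| n - \sum_i (r i).+1 by rewrite -eqn_mod_dvd // sr.
  rewrite mul1n -(@sum_residue_class _ _ n r) ?(mulnC P) ?divnK ?subnK // big_mkcond.
  apply: eq_bigr => x _; rewrite fE; case: forallP => [rx|_]; last by rewrite andbF.
  by rewrite (@good_congr _ P (fun i => x i) (fun i => r i)) ?gr // => i; rewrite -(eqP (rx i)) modn_mod.
apply: big1 => x; rewrite fE => /forallP rx; apply/eqP; rewrite eqb0.
have e i : x i = r i %[mod P] by rewrite -(eqP (rx i)) modn_mod.
apply: contra nr => /andP[/eqP sx gx].
by rewrite -(sum_succ_congr e) -(good_congr e) gx [X in X %% P]sx eqxx.
Qed.

(** For a residue sum s with n - s = M P, the bounds 0 <= s <= (k+1) P give n - k P <= (M+1) P and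
    (M+k) P <= n + k P; then [ffact_bounds] applies. *)
Lemma nsieve_bounds k P n : 0 < P -> k.+1 * P <= n ->
  (nres k.+1 P n * (n - k * P) ^ k <= nsieve k.+1 P n * k`! * P ^ k)
  && (nsieve k.+1 P n * k`! * P ^ k <= nres k.+1 P n * (n + k * P) ^ k).
Proof.
move=> P0 le_kPn; rewrite nsieve_residue_classes // /nres -!mulnA !big_distrl /=.
have main (r : {ffun 'I_k.+1 -> 'I_P}) : \sum_i (r i).+1 = n %[mod P] ->
  (n - k * P) ^ k <= 'C((n - \sum_i (r i).+1) %/ P + k, k) * (k`! * P ^ k)
    <= (n + k * P) ^ k.
  move=> sr; rewrite mulnA bin_ffact; set s := \sum_i _.
  have le_skP : s <= k.+1 * P.
    by rewrite -[k.+1]card_ord -sum_nat_const; apply: leq_sum.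
  have le_sn := leq_trans le_skP le_kPn.
  have dv : P %| n - s by rewrite -eqn_mod_dvd // sr.
  have := divnK dv; set M := _ %/ P => defM.
  have /andP[lo hi] := ffact_bounds M k.
  apply/andP; split.
    apply: leq_trans (leq_mul lo (leqnn _)); rewrite -expnMn.
    have: n - k * P <= M.+1 * P by nia.
    by case: (k) => // k' le1; rewrite leq_exp2r.
  apply: leq_trans (leq_mul hi (leqnn _)) _; rewrite -expnMn.
  have: (M + k) * P <= n + k * P by nia.
  by case: (k) => // k' le1; rewrite leq_exp2r.
by apply/andP; split; apply: leq_sum => r _; rewrite -mulnA;
  case: eqP => //= sr; case: good => //; rewrite !mul1n; have /andP[] := main r sr.
Qed.

(** * Local densities *)

Definition nmultiples k m (x : 'I_k -> nat) : nat := \sum_i (m %| (x i).+1).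

(** The bound [c] is general because the recursion for c = 1, the case of interest, involves c =
    0. *)
Definition nresidues_low c k p s : nat :=
  \sum_(f : {ffun 'I_k -> 'I_p}) ((\sum_i (f i).+1 == s %[mod p]) && (nmultiples p (fun i => f i) <= c)).

Definition ntot c k p : nat := \sum_(f : {ffun 'I_k -> 'I_p}) (nmultiples p (fun i => f i) <= c).

Lemma good_prime k p (x : 'I_k -> nat) : prime p -> good p x = (nmultiples p x <= 1).
Proof.
move=> pp; rewrite /nmultiples -big_mkcond sum1_card.
apply/goodP/card_le1_eqP => [h i j|h i j].
  move=> pi pj; have {}pi : p %| (x i).+1 := pi; have {}pj : p %| (x j).+1 := pj.
  apply/eqP; apply: contraT => ij.
  by have := h j i ij; rewrite prime_coprime // dvdn_gcd pi pj.
apply: contraR; rewrite prime_coprime // negbK dvdn_gcd => /andP[pi pj].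
by apply/eqP/h.
Qed.

Lemma nmultiples_insert k p (x : 'I_p) (f : {ffun 'I_k -> 'I_p}) :
  nmultiples p (fun i => ffun_insert ord0 x f i) = (p %| x.+1) + nmultiples p (fun i => f i).
Proof. exact: (sum_ffun_insert_ord _ _ _ (fun y : 'I_p => (p %| y.+1) : nat)). Qed.

Lemma sum_one_residue p t s : 0 < p -> \sum_(x < p) (x.+1 + t == s %[mod p]) = 1.
Proof.
(* The witness is s - t - 1 modulo [p], written without subtraction. *)
move=> p0; rewrite (bigD1 (Ordinal (ltn_pmod (s + (p.-1) * t.+1) p0))) //= big1.
  rewrite addn0; apply/eqP; rewrite eqb1 addSnnS modnDml.
  by rewrite -addnA -mulSnr prednK // addnC mulnC modnMDl.
move=> x nx; apply/eqP; rewrite eqb0; apply: contra nx => /eqP e.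
apply/eqP/val_inj => /=; rewrite -modnDml -e modnDml addSnnS -addnA.
by rewrite -mulSn prednK // addnC mulnC modnMDl modn_small.
Qed.

Lemma sum_ord_dvd q (G : 'I_q.+1 -> nat) :
  \sum_(x < q.+1) (q.+1 %| x.+1) * G x = G ord_max.
Proof.
rewrite (bigD1 ord_max) //= dvdnn mul1n big1 ?addn0 // => x nx.
rewrite gtnNdvd ?mul0n // ltnS ltn_neqAle -ltnS ltn_ord andbT.
by apply: contra nx => /eqP e; apply/eqP/val_inj.
Qed.

(* The other entries determine the first one mod p: it is divisible by p exactly
   when they already add up to s, and then only c - 1 of them may be too. *)
Lemma nresidues_low_rec c k p s : 0 < p ->
  nresidues_low c k.+1 p s + nresidues_low c k p s = (0 < c) * nresidues_low c.-1 k p s + ntot c k p.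
Proof.
case: p => // q _; set p := q.+1; rewrite {1}/nresidues_low (sum_ffun_insert ord0).
under eq_bigr => x _ do under eq_bigr => f _ do
  rewrite (sum_ffun_insert_ord _ _ _ (fun y : 'I_p => y.+1)) nmultiples_insert.
have shift c' : nresidues_low c' k p s = \sum_(x < p) (p %| x.+1) *
    \sum_(f : {ffun 'I_k -> 'I_p}) ((x.+1 + \sum_i (f i).+1 == s %[mod p]) && (nmultiples p (fun i => f i) <= c')).
  rewrite (sum_ord_dvd (fun x : 'I_p => \sum_(f : {ffun 'I_k -> 'I_p})
    ((x.+1 + \sum_i (f i).+1 == s %[mod p]) && (nmultiples p (fun i => f i) <= c')))).
  by apply: eq_bigr => f _; rewrite [nat_of_ord _]/= -/p modnDl.
have -> : ntot c k p = \sum_(x < p) \sum_(f : {ffun 'I_k -> 'I_p})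
    ((x.+1 + \sum_i (f i).+1 == s %[mod p]) && (nmultiples p (fun i => f i) <= c)).
  rewrite exchange_big; apply: eq_bigr => f _.
  under eq_bigr do rewrite -mulnb; rewrite -big_distrl.
  by rewrite (@sum_one_residue p _ s) //= mul1n.
rewrite !shift big_distrr -!big_split; apply: eq_bigr => x _ /=.
case: (p %| x.+1); last by rewrite !mul0n muln0 addn0 add0n; apply: eq_bigr.
rewrite !mul1n; congr (_ + _).
case: c {shift} => [|c]; last by rewrite mul1n.
by rewrite mul0n; apply: big1 => f _; rewrite andbF.
Qed.

(** The first entry is a multiple of [p] for one of its [p] values, and then uses up one of the [c]
    permitted multiples. *)
Lemma ntot_rec c k p : 0 < p ->
  ntot c k.+1 p = (0 < c) * ntot c.-1 k p + p.-1 * ntot c k p.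
Proof.
case: p => // q _; set p := q.+1; rewrite {1}/ntot (sum_ffun_insert ord0).
rewrite (bigD1 ord_max) //=; congr (_ + _).
  case: c => [|c].
    by rewrite mul0n; apply: big1 => f _; rewrite nmultiples_insert dvdnn.
  by rewrite mul1n; apply: eq_bigr => f _; rewrite nmultiples_insert dvdnn.
rewrite (eq_bigr (fun=> ntot c k p)) => [|x nx].
  by rewrite sum_nat_const cardC1 card_ord.
apply: eq_bigr => f _; rewrite nmultiples_insert gtnNdvd // ltnS ltn_neqAle -ltnS ltn_ord andbT.
by apply: contra nx => /eqP e; apply/eqP/val_inj.
Qed.

Lemma nresidues_low_nil c p s : nresidues_low c 0 p s = (p %| s).
Proof.
rewrite /nresidues_low (eq_bigr (fun=> (p %| s) : nat)) => [|f _].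
  by rewrite sum_nat_const card_ffun !card_ord mul1n.
by rewrite /nmultiples !big_ord0 andbT eq_sym mod0n.
Qed.

Lemma ntot_nil c p : ntot c 0 p = 1.
Proof.
rewrite /ntot (eq_bigr (fun=> 1)) => [|f _].
  by rewrite sum1_card card_ffun !card_ord.
by rewrite /nmultiples big_ord0.
Qed.

Local Open Scope ring_scope.

Section LocalCount.
Variables (R : realType) (p s : nat).
Hypothesis p_gt0 : (0 < p)%N.
Let q : R := p%:R - 1.
(** The Ramanujan sum of [s] modulo [p]: p - 1 if p divides s, and -1 otherwise. *)
Let e : R := p%:R * (p %| s)%:R - 1.

Let qE : (p.-1)%:R = q :> R.
Proof. by rewrite /q -{2}(prednK p_gt0) -natr1 addrK. Qed.

Lemma ntot0E k : (ntot 0 k p)%:R = q ^+ k.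
Proof.
elim: k => [|k IH]; first by rewrite ntot_nil.
by rewrite ntot_rec // mul0n add0n natrM qE IH exprS.
Qed.

Lemma ntot1E k : (ntot 1 k p)%:R = q ^+ k + k%:R * q ^+ k.-1.
Proof.
elim: k => [|k IH]; first by rewrite ntot_nil mul0r addr0.
rewrite ntot_rec // mul1n natrD natrM qE ntot0E IH -natr1.
by case: k {IH} => [|k]; rewrite /= ?exprS; ring.
Qed.

(** For c = 0 the counts satisfy N_{k+1} + N_k = q^k, so the deviation of N_k from q^k/p only
    changes sign at each step. *)
Lemma nresidues_low0E k : p%:R * (nresidues_low 0 k p s)%:R = q ^+ k + (-1) ^+ k * e.
Proof.
elim: k => [|k IH]; first by rewrite nresidues_low_nil !expr0 mul1r /e addrC subrK.
have /(congr1 (fun m => m%:R : R)) := nresidues_low_rec 0 k s p_gt0.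
rewrite mul0n add0n natrD ntot0E => /(canRL (addrK _)) ->.
rewrite mulrBr IH !exprS; have -> : p%:R = q + 1 by rewrite subrK.
ring.
Qed.

(** Each step of the recursion flips the sign of the [e] term and adds one more copy coming from c =
    0, whence the factor [k]. *)
Lemma nresidues_low1E k : p%:R * (nresidues_low 1 k.+1 p s)%:R =
  q ^+ k.+1 + k.+1%:R * q ^+ k + (-1) ^+ k * k%:R * e.
Proof.
have rec m : (nresidues_low 1 m.+1 p s)%:R = (nresidues_low 0 m p s)%:R + (ntot 1 m p)%:R - (nresidues_low 1 m p s)%:R :> R.
  have /(congr1 (fun m => m%:R : R)) := nresidues_low_rec 1 m s p_gt0.
  by rewrite mul1n !natrD => /(canRL (addrK _)).
have pE : p%:R = q + 1 by rewrite subrK.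
elim: k => [|k IH].
  by rewrite rec mulrBr mulrDr nresidues_low0E !nresidues_low_nil ntot_nil /e pE !expr0 expr1; ring.
rewrite rec mulrBr mulrDr nresidues_low0E ntot1E IH -!natr1 pE !exprS /=; ring.
Qed.

End LocalCount.

(** The factor at [p] of the product D_k g_k(n). *)
Definition local_density (R : realType) k n p : R :=
  delta k p%:R / p%:R ^+ k.-1 *
    (if (p %| n)%N then 1 + (-1) ^+ k.-1 * (k%:R - 1) / delta k p%:R else 1).

Lemma prime_subr1_ge1 (R : realType) p : prime p -> 1 <= p%:R - 1 :> R.
Proof. by move=> /prime_gt1 p1; rewrite lerBrDr -[1 + 1]/(2%:R) ler_nat. Qed.

Lemma delta_gt0 (R : realType) k p : (0 < k)%N -> prime p -> 0 < delta k (p%:R : R).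
Proof.
case: k => // k _ pp; have q1 := prime_subr1_ge1 R pp.
rewrite /delta /= divr_gt0 ?ltr0n ?prime_gt0 // -natr1 addrK.
set q := p%:R - 1 in q1 *.
have qk j : 1 <= q ^+ j by rewrite exprn_ege1.
have k0 : 0 <= k%:R :> R by [].
have : -1 * k%:R <= (-1) ^+ k.+1 * k%:R :> R.
  by rewrite ler_wpM2r // -signr_odd; case: odd; rewrite ?expr0 ?expr1 // lerN10.
by have := qk k; have := qk k.+1; nra.
Qed.

(** Clearing denominators gives the shape of the count in [nresidues_low1E]. *)
Lemma local_densityE (R : realType) k n p : (1 < k)%N -> prime p ->
  local_density R k n p * p%:R ^+ k =
  (p%:R - 1) ^+ k + k%:R * (p%:R - 1) ^+ k.-1
    + (-1) ^+ k.-1 * (k%:R - 1) * (p%:R * (p %| n)%:R - 1).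
Proof.
case: k => // k _ pp; have d0 : delta k.+1 (p%:R : R) != 0 by rewrite gt_eqF ?delta_gt0.
have p0 : p%:R != 0 :> R by rewrite pnatr_eq0 -lt0n prime_gt0.
rewrite /local_density /=.
transitivity (p%:R * delta k.+1 (p%:R : R) +
   (-1) ^+ k * (k.+1%:R - 1) * (p%:R * (p %| n)%:R)).
  rewrite exprS; have pk0 : p%:R ^+ k != 0 :> R by rewrite expf_neq0.
  move: (delta _ _) d0 (p%:R ^+ k) pk0 => d d0 y y0.
  by case: (p %| n)%N; rewrite /= ?mulr1n ?mulr0n; field; rewrite ?y0 ?d0.
by rewrite /delta /= !exprS; field.
Qed.

Lemma nres_prime (R : realType) k n p : (1 < k)%N -> prime p ->
  (nres k p n)%:R = local_density R k n p * p%:R ^+ k.-1.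
Proof.
case: k => // k k1 pp; have p0 : p%:R != 0 :> R by rewrite pnatr_eq0 -lt0n prime_gt0.
have kE : k.+1%:R - 1 = k%:R :> R by rewrite -natr1 addrK.
apply: (mulfI p0); rewrite mulrCA -exprS local_densityE //= kE -nresidues_low1E ?prime_gt0 //.
congr (_ * _%:R); apply: eq_bigr => r _.
by rewrite good_prime.
Qed.

(** Three terms of the binomial expansion; with exponent at least 3 the linear one is separate from
    the second highest. It will absorb the correction depending on [n]. *)
Lemma pow_succ_ge (R : realType) (x : R) k : 1 <= x ->
  x ^+ k.+3 + k.+3%:R * x ^+ k.+2 + k.+3%:R * x <= (x + 1) ^+ k.+3.
Proof.
move=> x1; elim: k => [|k IH]; first by rewrite !exprS expr0; nra.
have x0 : 0 <= x + 1 by lra.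
rewrite [leRHS]exprS; apply: le_trans (ler_wpM2l x0 IH).
have xk : 1 <= x ^+ k.+1 by rewrite exprn_ege1.
have : x <= x ^+ k.+2 by rewrite exprS; nra.
have k0 : 0 <= k%:R :> R by [].
rewrite -!natr1 (exprS x k.+3) (exprS x k.+2); set y := x ^+ k.+2; nra.
Qed.

(** Second-order Taylor expansion, the remainder taken at the right endpoint. *)
Lemma pow_succ_le (R : realType) (x : R) k : 0 <= x ->
  (x + 1) ^+ k.+2 <= x ^+ k.+2 + k.+2%:R * x ^+ k.+1 + k.+2%:R * k.+1%:R / 2 * (x + 1) ^+ k.
Proof.
move=> x0; elim: k => [|k IH]; first by rewrite !exprS expr0; nra.
have x1 : 0 <= x + 1 by lra.
rewrite [leLHS]exprS; apply: le_trans (ler_wpM2l x1 IH) _.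
have k0 : 0 <= k%:R :> R by [].
have : 0 <= (k%:R + 2) * ((x + 1) ^+ k.+1 - x ^+ k.+1).
  by rewrite mulr_ge0 ?subr_ge0 ?lerXn2r ?nnegrE //; lra.
rewrite -[k.+3%:R]natr1 -[k.+2%:R]natr1 -[k.+1%:R]natr1.
rewrite (exprS x k.+2) (exprS x k.+1) (exprS (x + 1) k).
by set y := x ^+ k.+1; set z := (x + 1) ^+ k; lra.
Qed.

(** Nonnegative as a normalised count, and at most 1 by [pow_succ_ge]. In the deficit, in units of
    p^(k-2), the Taylor remainder gives k(k-1)/2 and the correction at most k-1, together below
    k^2. *)
Lemma local_density_bounds (R : realType) k n p : (2 < k)%N -> prime p ->
  0 <= local_density R k n p <= 1 /\
  1 - local_density R k n p <= k%:R ^+ 2 / p%:R ^+ 2.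
Proof.
move=> k2 pp; have k1 := ltnW k2.
have p0 : 0 < p%:R :> R by rewrite ltr0n prime_gt0.
have pk m : 0 < p%:R ^+ m :> R by rewrite exprn_gt0.
split; first apply/andP; first split.
- by rewrite -(pmulr_lge0 _ (pk k.-1)) -nres_prime.
all: have q1 := prime_subr1_ge1 R pp; have := local_densityE R n k1 pp.
all: case: k k1 k2 => [|[|[|k]]] // _ _ /=; set q : R := p%:R - 1 in q1 *;
     set a := local_density _ _ _ _; move=> aE; have pE : p%:R = q + 1 by rewrite subrK.
- rewrite -(ler_pM2r (pk k.+3)) mul1r aE pE.
  apply: le_trans (pow_succ_ge k q1); rewrite lerD2l.
  have k0 : 0 <= k%:R :> R by [].
  have kq : k%:R <= k%:R * q by rewrite ler_peMr.
  rewrite -[k.+3%:R]natr1 -[k.+2%:R]natr1 -[k.+1%:R]natr1 -signr_odd.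
  by case: (p %| n)%N; case: odd; rewrite /= ?mulr1n ?mulr0n ?expr0 ?expr1; lra.
- rewrite ler_pdivlMr // -(ler_pM2r (pk k.+1)) -mulrA -exprD addSn add1n mulrBl mul1r aE pE.
  have q0 : 0 <= q by lra.
  have := pow_succ_le k.+1 q0.
  have k0 : 0 <= k%:R :> R by [].
  have qw : q <= (q + 1) ^+ k.+1.
    apply: (@le_trans _ _ (q + 1)); first by lra.
    by rewrite exprS ler_peMr ?exprn_ege1 //; lra.
  have kqw : (k%:R + 2) * q <= (k%:R + 2) * (q + 1) ^+ k.+1 by rewrite ler_wpM2l //; lra.
  have kq : k%:R <= k%:R * q by rewrite ler_peMr.
  have w0 : 0 <= (k%:R ^+ 2 + k%:R) * (q + 1) ^+ k.+1.
    by rewrite mulr_ge0 ?exprn_ge0 //; nra.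
  have w1 : 0 <= k%:R * (q + 1) ^+ k.+1 by rewrite mulr_ge0 ?exprn_ge0 //; lra.
  rewrite -[k.+3%:R]natr1 -[k.+2%:R]natr1 -[k.+1%:R]natr1.
  rewrite -signr_odd.
  by case: (p %| n)%N; case: odd; rewrite /= ?mulr1n ?mulr0n ?expr0 ?expr1; lra.
Qed.

(** * Tuples with a large common prime *)

Local Open Scope nat_scope.

Lemma sum_ord_dvdS n p : \sum_(x < n) (p %| x.+1) = n %/ p.
Proof. by rewrite divn_count_dvd big_add1 /= big_mkord. Qed.

Lemma sum_shifted_compositions_le k n c : 2 <= c ->
  (\sum_(z : {ffun 'I_k.+1 -> 'I_n}) (c + \sum_i (z i).+1 == n)) * k`! <= n ^ k.
Proof.
move=> c2; have e (z : {ffun 'I_k.+1 -> 'I_n}) : \sum_i (z i).+1 = \sum_i z i + k.+1.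
  by under eq_bigr do rewrite -addn1; rewrite big_split /= sum1_card card_ord.
have [le_cn|lt_nc] := leqP (c + k.+1) n; last first.
  by rewrite big1 // => z _; apply/eqP; rewrite eqb0 e; set t := bigop _ _ _; lia.
have lt_n : n - (c + k.+1) < n by lia.
rewrite (eq_bigr (fun z : {ffun 'I_k.+1 -> 'I_n} => (\sum_i z i == n - (c + k.+1)) : nat)).
  rewrite sum_compositions // bin_ffact; have /andP[_ hi] := ffact_bounds (n - (c + k.+1)) k.
  apply: leq_trans hi _; case: (k) le_cn => // k' le_cn; rewrite leq_exp2r //; lia.
by move=> z _; congr nat_of_bool; rewrite e; set t := bigop _ _ _; lia.
Qed.

(** Entries [i] and [j] have [n %/ p] choices each; the other [k.+1] entries then have a prescribed
    sum. *)
Lemma pair_multiples_le k n p (i j : 'I_k.+3) : i != j ->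
  (\sum_(x : {ffun 'I_k.+3 -> 'I_n})
     [&& \sum_l (x l).+1 == n, p %| (x i).+1 & p %| (x j).+1]) * k`!
  <= (n %/ p) ^ 2 * n ^ k.
Proof.
(* Position [j] becomes [lift i j'], so both entries can be peeled off. *)
move=> ij; have [j' defj|ej] := unliftP i j; last by rewrite ej eqxx in ij.
rewrite defj (sum_ffun_insert i).
under eq_bigr => x _ do rewrite (sum_ffun_insert j').
under eq_bigr => x _ do under eq_bigr => y _ do under eq_bigr => z _ do
  rewrite !(sum_ffun_insert_ord _ _ _ (fun u : 'I_n => u.+1)) ffun_insert_lift !ffun_insert_at andbC addnA -mulnb.
under eq_bigr => x _ do under eq_bigr => y _ do rewrite -big_distrr /= -mulnb -mulnA.
under eq_bigr => x _ do rewrite -big_distrr /=.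
rewrite -mulnn -{1}(sum_ord_dvdS n p) -!mulnA !big_distrl; apply: leq_sum => x _ /=.
rewrite -mulnA leq_mul // -(sum_ord_dvdS n p) !big_distrl; apply: leq_sum => y _ /=.
rewrite -mulnA leq_mul //; apply: (@sum_shifted_compositions_le k n (x.+1 + y.+1)).
by rewrite addnS.
Qed.

(** * Pairwise coprime tuples and primorials *)

Definition pcoprime k (x : 'I_k -> nat) : bool :=
  [forall i, forall j, (i != j) ==> coprime (x i).+1 (x j).+1].

(** Entries of [B] are successors of the stored ones, and symmetry of coprimality replaces [i < j]
    by [i != j]. *)
Lemma B_shift k n : 0 < n ->
  B k n = \sum_(x : {ffun 'I_k -> 'I_n})
    ((\sum_i (x i).+1 == n) && pcoprime (fun i => x i)).
Proof.
case: n => // n _; rewrite /B -sum1_card -[RHS]big_mkcond /=.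
pose up (x : {ffun 'I_k -> 'I_n.+1}) : {ffun 'I_k -> 'I_n.+2} := [ffun i => lift ord0 (x i)].
pose dn (x : {ffun 'I_k -> 'I_n.+2}) : {ffun 'I_k -> 'I_n.+1} := [ffun i => inord (x i).-1].
rewrite (reindex_onto up dn) /=; last first.
  move=> x; rewrite inE => /and3P[/forallP x0 _ _]; apply/ffunP => i; apply/val_inj.
  rewrite !ffunE /= /bump /= inordK ?add1n ?prednK //.
  by rewrite -ltnS ltn_ord.
apply: eq_bigl => x; rewrite inE.
have upE i : up x i = (x i).+1 :> nat by rewrite ffunE.
have -> : dn (up x) == x.
  by apply/eqP/ffunP => i; apply/val_inj; rewrite ffunE upE /= inordK.
rewrite andbT; have -> : [forall i, 0 < up x i] by apply/forallP => i; rewrite upE.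
rewrite (eq_bigr (fun i => (x i).+1)) /=; last by move=> i _; rewrite upE.
congr (_ && _); apply/forallP/forallP => h i; apply/forallP => j; apply/implyP => ij.
  move: ij; rewrite neq_ltn => /orP[] ij.
    by have /forallP/(_ j)/implyP/(_ ij) := h i; rewrite !upE.
  by have /forallP/(_ i)/implyP/(_ ij) := h j; rewrite !upE coprime_sym.
have /forallP/(_ j)/implyP := h i; rewrite !upE; apply.
by rewrite neq_ltn ij.
Qed.

(** The bound is strict: the primes up to [y] are those of [primorial y.+1]. *)
Definition primorial N := \prod_(0 <= p < N | prime p) p.

Lemma primorial_gt0 N : 0 < primorial N.
Proof. by apply: prodn_cond_gt0 => p /prime_gt0. Qed.

Lemma primorialS N : primorial N.+1 = primorial N * (if prime N then N else 1).
Proof. by rewrite /primorial big_mkcond big_nat_recr //= -big_mkcond. Qed.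

Lemma prime_dvd_primorial N p : prime p -> p < N -> p %| primorial N.
Proof.
move=> pp; elim: N => // N IH; rewrite ltnS leq_eqVlt primorialS => /orP[/eqP <-|/IH].
  by rewrite pp dvdn_mull.
exact: dvdn_mulr.
Qed.

Lemma coprime_primorial N : prime N -> coprime (primorial N) N.
Proof.
move=> pN; rewrite /primorial big_nat_cond.
apply: (big_ind (fun m => coprime m N)) => [|a b|p /andP[/andP[_ ltpN] pp]].
- exact: coprime1n.
- by rewrite coprimeMl => -> ->.
by rewrite prime_coprime // dvdn_prime2 // ltn_eqF.
Qed.

(** * Comparison of B with the sifted count *)

Lemma B_le_nsieve k m n : 0 < n -> B k n <= nsieve k m n.
Proof.
move=> n0; rewrite B_shift //; apply: leq_sum => x _.
case: (\sum_i _ == n) => //=; case: (boolP (pcoprime _)) => // /forallP cx.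
rewrite lt0b; apply/goodP => i j ij.
have /forallP/(_ j)/implyP/(_ ij)/eqP -> := cx i.
exact: coprimen1.
Qed.

(** Union bound: a sifted tuple that is not pairwise coprime has two entries with a common prime p,
    where y < p <= n. *)
Lemma nsieve_le_B k n y : 0 < n ->
  nsieve k (primorial y.+1) n <= B k n +
   \sum_(y.+1 <= p < n.+1) \sum_(i < k) \sum_(j < k | i != j)
      \sum_(x : {ffun 'I_k -> 'I_n})
        [&& \sum_l (x l).+1 == n, p %| (x i).+1 & p %| (x j).+1].
Proof.
move=> n0; rewrite B_shift //.
under eq_bigr => p _ do under eq_bigr => i _ do rewrite exchange_big /=.
under eq_bigr => p _ do rewrite exchange_big /=.
rewrite exchange_big -big_split; apply: leq_sum => x _ /=.
case: eqP => //= sx; case: (boolP (good _ _)) => // /goodP gx.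
case: (boolP (pcoprime _)) => //=.
case/forallPn => i /forallPn[j]; rewrite negb_imply => /andP[ij ncij].
set d := gcdn (x i).+1 (x j).+1.
have d1 : 1 < d by rewrite ltn_neqAle eq_sym ncij gcdn_gt0.
(* The least prime factor of the gcd exceeds [y] because the tuple has passed the sieve. *)
pose p := pdiv d; have pp : prime p by apply: pdiv_prime.
have /andP[pi pj] : (p %| (x i).+1) && (p %| (x j).+1) by rewrite -dvdn_gcd pdiv_dvd.
have yp : y < p.
  rewrite ltnNge; apply/negP => le_py.
  have := gx i j ij; rewrite /coprime => /eqP g1.
  have : p %| gcdn (primorial y.+1) d by rewrite dvdn_gcd pdiv_dvd prime_dvd_primorial.
  by rewrite g1 dvdn1 => /eqP p1; rewrite p1 in pp.
have pn : p < n.+1.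
  by rewrite ltnS (leq_trans (dvdn_leq _ pi)) // ltn_ord.
(* The single term at [p], [i], [j] of the triple sum is already 1. *)
rewrite add0n (big_cat_nat (n := p)) // ?[p <= n.+1]ltnW //= addn_gt0; apply/orP; right.
rewrite big_ltn // addn_gt0; apply/orP; left.
by rewrite (bigD1 i) //= (bigD1 j) //= pi pj.
Qed.

Lemma nsieve_tail k n y : 0 < n ->
  nsieve k.+3 (primorial y.+1) n * k`! <= B k.+3 n * k`! +
    k.+3 ^ 2 * n ^ k * \sum_(y.+1 <= p < n.+1) (n %/ p) ^ 2.
Proof.
move=> n0; apply: leq_trans (leq_mul (nsieve_le_B _ _ n0) (leqnn _)) _.
rewrite mulnDl leq_add2l big_distrl big_distrr; apply: leq_sum => p _ /=.
apply: (@leq_trans (\sum_(i < k.+3) \sum_(j < k.+3) (n %/ p) ^ 2 * n ^ k)); last first.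
  rewrite !sum_nat_const card_ord; apply: eq_leq.
  by move: (n ^ k) ((n %/ p) ^ 2) => a b; ring.
rewrite big_distrl; apply: leq_sum => i _ /=.
rewrite big_distrl [leqRHS](bigID (fun j => i != j)) /=.
by apply: leq_trans (leq_addr _ _); apply: leq_sum => j; apply: pair_multiples_le.
Qed.

(** * Size of the primorial *)

Lemma prod_primes_dvd a b m :
  (forall p, a <= p < b -> prime p -> p %| m) -> \prod_(a <= p < b | prime p) p %| m.
Proof.
elim: b => [|b IH] h; first by rewrite big_geq // dvd1n.
have [le_ab|lt_ba] := leqP a b; last by rewrite big_geq // dvd1n.
rewrite big_mkcond big_nat_recr //= -big_mkcond /=.
have dv : \prod_(a <= p < b | prime p) p %| m.
  by apply: IH => p /andP[ap pb]; apply: h; rewrite ap ltnW.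
case: ifP => pb; last by rewrite muln1.
rewrite Gauss_dvd ?dv ?h ?le_ab ?ltnSn // big_nat_cond.
apply: (big_ind (fun d => coprime d b)) => [|c d|p /andP[/andP[_ ltpb] pp]].
- exact: coprime1n.
- by rewrite coprimeMl => -> ->.
by rewrite prime_coprime // dvdn_prime2 // ltn_eqF.
Qed.

Lemma prime_dvd_fact p m : prime p -> p %| m`! -> p <= m.
Proof.
move=> pp; elim: m => [|m IH]; first by rewrite fact0 dvdn1 => /eqP p1; rewrite p1 in pp.
by rewrite factS Euclid_dvdM // => /orP[/dvdn_leq ->|/IH /leqW].
Qed.

Lemma bin_le_exp n m : 'C(n, m) <= 2 ^ n.
Proof.
elim: n m => [|n IH] [|m] //; first by rewrite bin0 expn_gt0.
by rewrite binS expnS mul2n -addnn leq_add.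
Qed.

(** A prime in ]m, 2m] divides (2m)! but not m!, hence divides the central binomial coefficient. *)
Lemma primorial_double m : primorial m.*2.+1 <= primorial m.+1 * 4 ^ m.
Proof.
rewrite /primorial (big_cat_nat (n := m.+1)) //=; last by rewrite ltnS -addnn leq_addr.
rewrite leq_mul2l; apply/orP; right.
apply: (@leq_trans 'C(m.*2, m)).
  apply: dvdn_leq; first by rewrite bin_gt0 -addnn leq_addr.
  apply: prod_primes_dvd => p /andP[mp pm] pp.
  have : p %| (m.*2)`! by rewrite dvdn_fact // prime_gt0.
  rewrite -(@bin_fact m.*2 m) -?addnn ?leq_addr // addnK !Euclid_dvdM //.
  by case/or3P => // /(prime_dvd_fact pp); rewrite leqNgt mp.
by apply: leq_trans (bin_le_exp _ _) _; rewrite -mul2n expnM.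
Qed.

Lemma primorial_pow2 j : primorial (2 ^ j).+1 <= 4 ^ (2 ^ j).
Proof.
elim: j => [|j IH]; first by rewrite expn0 !primorialS /primorial big_geq.
rewrite expnS mul2n; apply: leq_trans (primorial_double _) _.
by rewrite -addnn expnD leq_mul.
Qed.

Local Open Scope ring_scope.

(** [nres] is multiplicative, and one prime is split off at a time. *)
Lemma nres_primorial (R : realType) k N n : (1 < k)%N ->
  (nres k (primorial N) n)%:R =
  (\prod_(0 <= p < N | prime p) local_density R k n p) * (primorial N)%:R ^+ k.-1.
Proof.
move=> k1; elim: N => [|N IH].
  (* Modulo 1 there is one residue tuple, and it meets both conditions. *)
  rewrite /primorial !big_geq // expr1n mul1r; apply/eqP; rewrite pnatr_eq1; apply/eqP.
  rewrite /nres (eq_bigr (fun=> 1%N)) => [|r _].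
    by rewrite sum1_card card_ffun !card_ord exp1n.
  by rewrite !modn1 eqxx; case: goodP => // -[] i j _; apply: coprime1n.
rewrite primorialS [in RHS]big_mkcond big_nat_recr //= -big_mkcond /=.
case: ifP => pN; last by rewrite muln1 mulr1.
rewrite nres_mul ?primorial_gt0 ?prime_gt0 ?coprime_primorial //.
by rewrite !natrM IH nres_prime // exprMn mulrACA.
Qed.

(** * The infinite product *)

Lemma sum_inv_sqr (R : realType) y N : (0 < y)%N ->
  \sum_(y.+1 <= p < N) (p%:R ^+ 2)^-1 <= y%:R^-1 :> R.
Proof.
move=> y0; have [le_Ny|lt_yN] := leqP N y.+1.
  by rewrite big_geq // invr_ge0.
rewrite -(subnKC (ltnW lt_yN)); move: (N - y.+1)%N => d.
(* Telescoping: the term 1/(y+d) is kept in the induction, as 1/(t+1)^2 <= 1/t - 1/(t+1). *)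
apply: (@le_trans _ _ (y%:R^-1 - (y + d)%:R^-1)); last by rewrite gerBl invr_ge0.
elim: d => [|d IH]; first by rewrite !addn0 big_geq // subrr.
rewrite addnS big_nat_recr ?leq_addr //= addSn addnS -[(y + d).+1%:R]natr1.
have t0 : 0 < (y + d)%:R :> R by rewrite ltr0n addn_gt0 y0.
apply: le_trans (lerD IH (lexx _)) _; set t := _%:R in t0 *.
suff : 0 <= t^-1 - ((t + 1) ^- 2 + (t + 1)^-1) by lra.
have -> : t^-1 - ((t + 1) ^- 2 + (t + 1)^-1) = t^-1 * (t + 1) ^- 2.
  by field; apply/andP; split; lra.
by rewrite mulr_ge0 ?invr_ge0 ?exprn_ge0 //; lra.
Qed.

Definition sieve_density (R : realType) k n N : R :=
  \prod_(0 <= p < N | prime p) local_density R k n p.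

Section SieveDensity.
Variables (R : realType) (k n : nat).
Hypothesis k_gt2 : (2 < k)%N.
Local Notation F := (sieve_density R k n).

Lemma sieve_densityS N : F N.+1 = F N * (if prime N then local_density R k n N else 1).
Proof. by rewrite /sieve_density big_mkcond big_nat_recr //= -big_mkcond. Qed.

Lemma sieve_density_ge0_le1 N : 0 <= F N <= 1.
Proof.
elim: N => [|N /andP[IH0 IH1]]; first by rewrite /sieve_density big_geq // ler01 lexx.
rewrite sieve_densityS; case: ifP => pN; last by rewrite mulr1 IH0.
have [/andP[a0 a1] _] := local_density_bounds R n k_gt2 pN.
by rewrite mulr_ge0 //= mulr_ile1.
Qed.

Lemma sieve_density_le M N : (M <= N)%N -> F N <= F M.
Proof.
move=> /subnKC <-; elim: (N - M)%N => [|d IH]; first by rewrite addn0.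
rewrite addnS (le_trans _ IH) // sieve_densityS; case: ifP => pN; last by rewrite mulr1.
have [/andP[a0 a1] _] := local_density_bounds R n k_gt2 pN.
by have /andP[? _] := sieve_density_ge0_le1 (M + d); rewrite ler_piMr.
Qed.

(** A prime factor at M lowers the product F by F(M) times its deficit, at most k^2/M^2 since F(M)
    <= 1; [sum_inv_sqr] adds up these losses. *)
Lemma sieve_density_tail y N : (0 < y)%N -> (y < N)%N ->
  F y.+1 - k%:R ^+ 2 / y%:R <= F N.
Proof.
move=> y0 yN; suff h : F y.+1 - F N <= k%:R ^+ 2 * \sum_(y.+1 <= p < N) (p%:R ^+ 2)^-1.
  rewrite lerBlDl -lerBlDr; apply: le_trans h _.
  by rewrite ler_wpM2l ?exprn_ge0 // sum_inv_sqr.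
rewrite -(subnKC yN); elim: (N - y.+1)%N => [|d IH].
  by rewrite addn0 subrr big_geq // mulr0.
rewrite addnS big_nat_recr ?leq_addr //= mulrDr.
move: (y.+1 + d)%N IH => M IH; rewrite (sieve_densityS M); have /andP[F0 F1] := sieve_density_ge0_le1 M.
have kM : 0 <= k%:R ^+ 2 / M%:R ^+ 2 :> R by rewrite divr_ge0 ?exprn_ge0.
case: ifP => pM; last by rewrite mulr1 (le_trans IH) // lerDl.
have [/andP[a0 a1] h] := local_density_bounds R n k_gt2 pM.
have : F M * (1 - local_density R k n M) <= k%:R ^+ 2 / M%:R ^+ 2.
  by apply: le_trans h; rewrite ler_piMl // subr_ge0.
by set e := _ / _; lra.
Qed.

End SieveDensity.

(** Once N > n the product contains every prime divisor of [n]; no prime divides 1, so the case n =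
    1 isolates the factors of D_k. *)
Lemma sieve_density_factor (R : realType) k n N : (0 < n)%N -> (n < N)%N ->
  sieve_density R k n N = sieve_density R k 1 N * g R k n.
Proof.
move=> n0 nN; rewrite /g.
have -> : \prod_(p <- primes n) (1 + (-1) ^+ k.-1 * (k%:R - 1) / delta k (p%:R : R)) =
  \prod_(0 <= p < N | prime p)
    (if (p %| n)%N then 1 + (-1) ^+ k.-1 * (k%:R - 1) / delta k (p%:R : R) else 1).
  rewrite -big_mkcondr -[RHS]big_filter; apply: perm_big.
  apply: uniq_perm; rewrite ?primes_uniq ?filter_uniq ?iota_uniq // => p.
  rewrite mem_filter mem_primes n0 mem_index_iota /=; case: prime => //=.
  case: (boolP (p %| n)%N) => //= dv; rewrite (leq_ltn_trans _ nN) //.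
  exact: dvdn_leq.
rewrite /sieve_density -big_split; apply: eq_bigr => p pp /=.
rewrite /local_density dvdn1 gtn_eqF ?prime_gt1 // mulr1.
by rewrite mulrAC.
Qed.

Lemma singular_series_bounds (R : realType) k n y : (2 < k)%N -> (0 < n)%N -> (0 < y)%N ->
  sieve_density R k n y.+1 - k%:R ^+ 2 / y%:R <= D R k * g R k n
    <= sieve_density R k n y.+1.
Proof.
move=> k2 n0 y0.
have DE : (fun N : nat => \prod_(0 <= p < N | prime p) (delta k (p%:R : R) / p%:R ^+ k.-1))
   = sieve_density R k 1.
  apply/funext => N; apply: eq_bigr => p pp.
  by rewrite /local_density dvdn1 gtn_eqF ?prime_gt1 // mulr1.
(* The partial products decrease and are bounded below, so the [limn] in [D] is a genuine limit. *)
have cD : cvgn (sieve_density R k 1).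
  apply: nonincreasing_is_cvgn; first by move=> M N; exact: sieve_density_le.
  exists 0 => _ [N _ <-]; by case/andP: (sieve_density_ge0_le1 R 1 k2 N).
have cF : (sieve_density R k n @ \oo --> D R k * g R k n)%classic.
  rewrite /D DE; apply: (@cvg_trans _ ((fun N => sieve_density R k 1 N * g R k n) @ \oo)%classic).
    apply: near_eq_cvg; near=> N; rewrite (sieve_density_factor R k n0) //.
    by near: N; exact: nbhs_infty_gt.
  by apply: cvgMl; exact: cD.
rewrite -(cvg_lim (@Rhausdorff R) cF); apply/andP; split.
  apply: limr_ge; first by apply/cvg_ex; eexists; exact: cF.
  near=> N; apply: sieve_density_tail => //; by near: N; exact: nbhs_infty_gt.
apply: limr_le; first by apply/cvg_ex; eexists; exact: cF.
near=> N; apply: sieve_density_le => //; by near: N; exact: nbhs_infty_gt.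
Unshelve. all: by end_near.
Qed.

(** * Numerical input and choice of the sieve level *)

Lemma sqr_le_fact k : (k.+3 ^ 2 <= 16 * k`!)%N.
Proof.
(* Equality at k = 1 dictates the constant 16; afterwards (k+5)^2 <= (k+2)(k+4)^2 carries the
   induction. *)
elim: k => // -[|k] IH //.
rewrite factS mulnCA; apply: leq_trans (leq_mul (leqnn _) IH).
by rewrite -!mulnn; nia.
Qed.

Lemma exists_scale n : (16 <= n)%N -> exists j, (16 ^ (2 ^ j) <= n < 16 ^ (2 ^ j.+1))%N.
Proof.
move=> n16; have n0 : (0 < n)%N by apply: leq_trans n16.
have /andP[lo hi] := trunc_log_bounds (isT : (1 < 16)%N) n0.
set L := trunc_log 16 n in lo hi.
have L0 : (0 < L)%N by rewrite trunc_log_gt0.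
have /andP[lo2 hi2] := trunc_log_bounds (isT : (1 < 2)%N) L0.
exists (trunc_log 2 L); apply/andP; split.
  by apply: leq_trans lo; rewrite leq_exp2l.
by apply: leq_trans hi _; rewrite leq_exp2l.
Qed.

(** * The case k >= 3 *)

Lemma bernoulli_sub (R : realType) (u : R) b : 0 <= u <= 1 -> 1 - b%:R * u <= (1 - u) ^+ b.
Proof.
move=> /andP[u0 u1]; elim: b => [|b IH]; first by rewrite mul0r subr0.
have v0 : 0 <= 1 - u by lra.
rewrite exprS; apply: le_trans (ler_wpM2l v0 IH); rewrite -natr1.
have : 0 <= b%:R * (u * u) by rewrite !mulr_ge0.
by lra.
Qed.

(** By Bernoulli (1+u)^b (1-bu) <= (1-u^2)^b <= 1, and (1+2t)(1-t) >= 1 for 0 <= t <= 1/2. *)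
Lemma expr1D_le (R : realType) (u : R) b :
  0 <= u -> b%:R * u <= 1 / 2 -> (0 < b)%N -> (1 + u) ^+ b <= 1 + 2 * (b%:R * u).
Proof.
move=> u0 bu b0; have b1 : 1 <= b%:R :> R by rewrite ler1n.
have u_bu : u <= b%:R * u by rewrite ler_peMl.
have u1 : 0 <= u <= 1 by rewrite u0; lra.
have v0 : 0 < 1 - b%:R * u by lra.
rewrite -(ler_pM2r v0); apply: (@le_trans _ _ 1); last by nra.
have x0 : 0 <= (1 + u) ^+ b by rewrite exprn_ge0 //; lra.
apply: le_trans (ler_wpM2l x0 (bernoulli_sub b u1)) _.
by rewrite -exprMn exprn_ile1 //; nra.
Qed.

(** With u = w/x the two bounds are F x^b (1-u)^b and F x^b (1+u)^b; as F <= 1, it drops out of the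
    error. *)
Lemma power_window (R : realType) b (F x w Z : R) : (0 < b)%N ->
  0 <= F <= 1 -> 0 < x -> 0 <= w -> b%:R * w / x <= 1 / 2 ->
  F * (x - w) ^+ b <= Z -> Z <= F * (x + w) ^+ b ->
  `|Z - F * x ^+ b| <= 2 * (b%:R * w / x) * x ^+ b.
Proof.
move=> b0 /andP[F0 F1] x0 w0; rewrite -mulrA; set u := w / x => bu lo hi.
have u0 : 0 <= u by rewrite divr_ge0 // ltW.
have wE : w = x * u by rewrite /u mulrCA divff ?mulr1 // gt_eqF.
have b1 : 1 <= b%:R :> R by rewrite ler1n.
have u_bu : u <= b%:R * u by rewrite ler_peMl.
have u1 : 0 <= u <= 1 by rewrite u0; lra.
have X0 : 0 <= x ^+ b by rewrite exprn_ge0 // ltW.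
have FX0 : 0 <= F * x ^+ b by rewrite mulr_ge0.
have FX1 : F * x ^+ b <= x ^+ b by rewrite ler_piMl.
have hiE : F * (x + w) ^+ b = F * x ^+ b * (1 + u) ^+ b.
  by rewrite -mulrA -exprMn mulrDr mulr1 wE.
have loE : F * (x - w) ^+ b = F * x ^+ b * (1 - u) ^+ b.
  by rewrite -mulrA -exprMn mulrBr mulr1 wE.
have hi' := ler_wpM2l FX0 (expr1D_le u0 bu b0).
have lo' := ler_wpM2l FX0 (bernoulli_sub b u1).
rewrite hiE in hi; rewrite loE in lo.
have t0 : 0 <= b%:R * u by lra.
have e := ler_wpM2r t0 FX1.
have e' : 0 <= F * x ^+ b * (b%:R * u) by rewrite mulr_ge0.
rewrite ler_norml; move: (b%:R * u) t0 e e' hi' lo' => t t0 e e' hi' lo'.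
by apply/andP; split; lra.
Qed.

Lemma leq_double_sqr y : (0 < y)%N -> (2 * y ^ 2 <= 4 ^ y)%N.
Proof.
case: y => // y _; have : (y < 2 ^ y)%N by apply: ltn_expl.
by rewrite -mulnn expnS -[(4 ^ y)%N]/((2 * 2) ^ y)%N expnMn; move: (2 ^ y)%N => z; nia.
Qed.

Lemma nsieve_asymptotic (R : realType) k n j (y := (2 ^ j)%N) : (k.+2 <= y)%N -> (16 ^ y <= n)%N ->
  `|(nsieve k.+3 (primorial y.+1) n)%:R * (k.+2)`!%:R
     - sieve_density R k.+3 n y.+1 * n%:R ^+ k.+2|
  <= 2 * k.+2%:R ^+ 2 / y%:R * n%:R ^+ k.+2.
Proof.
move=> ky yn; set b := k.+2; set P := primorial y.+1.
have y0 : (0 < y)%N by rewrite expn_gt0.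
have P0 : (0 < P)%N := primorial_gt0 _.
have P4 : (P <= 4 ^ y)%N := primorial_pow2 j.
have n0 : (0 < n)%N by apply: leq_trans yn; rewrite expn_gt0.
have x0 : 0 < n%:R :> R by rewrite ltr0n.
have nE : (4 ^ y * 4 ^ y <= n)%N by rewrite -expnMn.
have y4 := leq_double_sqr y0.
(* Both P and 2y are at most 4^y; this yields the saving of 1/y. *)
have wP : (b * P * (2 * y) <= n * b)%N.
  apply: (@leq_trans (4 ^ y * 4 ^ y * b)); last by rewrite leq_mul2r nE orbT.
  rewrite -mulnA mulnC leq_mul2r; apply/orP; right.
  by rewrite leq_mul //; apply: leq_trans y4; rewrite leq_mul2l -mulnn leq_pmulr.
(* From b <= y and 2y^2 <= 4^y: the relative width is at most 1/2, as [power_window] demands. *)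
have wP2 : (b * (b * P) * 2 <= n)%N.
  apply: leq_trans nE; rewrite mulnA mulnAC leq_mul // mulnC.
  by apply: leq_trans y4; rewrite leq_mul2l mulnn leq_exp2r.
have kPn : (k.+3 * P <= n)%N.
  by apply: leq_trans wP2; rewrite mulnA mulnAC leq_mul2r; apply/orP; right; rewrite /b; nia.
have w : b%:R * (b * P)%:R / n%:R <= b%:R ^+ 2 / y%:R / 2 :> R.
  rewrite ler_pdivrMr // natrM expr2 -!mulrA ler_wpM2l //.
  have y0R : 0 < y%:R :> R by rewrite ltr0n.
  have : (b * P * (2 * y))%:R <= (n * b)%:R :> R by rewrite ler_nat.
  rewrite !natrM => h; rewrite -(ler_pM2r y0R) -(@ler_pM2r _ 2) //.
  apply: le_trans (_ : _ <= n%:R * b%:R) _; first by lra.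
  by rewrite le_eqVlt; apply/orP; left; apply/eqP; field; rewrite gt_eqF.
have hw : b%:R * (b * P)%:R / n%:R <= 1 / 2 :> R.
  rewrite ler_pdivrMr // mulrAC mul1r ler_pdivlMr //.
  by rewrite -natrM -[2]/(2%:R) -natrM ler_nat.
have F01 := sieve_density_ge0_le1 R n (isT : (2 < k.+3)%N) y.+1.
have /andP[lo hi] := @nsieve_bounds b P n P0 kPn.
have bPn : (b * P <= n)%N by apply: leq_trans kPn; rewrite leq_mul2r leqnSn orbT.
have PX : 0 < P%:R ^+ b :> R by rewrite exprn_gt0 // ltr0n.
(* The window is w = b P; multiplying by P^b turns the density into [nres], to which [nsieve_bounds]
   applies. *)
apply: le_trans (power_window (w := (b * P)%:R) _ F01 x0 _ hw _ _) _ => //.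
- rewrite -(ler_pM2r PX) mulrAC -[k.+2]/(k.+3.-1) -nres_primorial //.
  by rewrite -natrB // -!natrX -!natrM ler_nat.
- rewrite -(ler_pM2r PX) [leRHS]mulrAC -[k.+2]/(k.+3.-1) -nres_primorial //.
  by rewrite -natrD -!natrX -!natrM ler_nat.
rewrite ler_wpM2r ?exprn_ge0 //.
rewrite -[leRHS]mulrA; have : 0 <= b%:R ^+ 2 / y%:R :> R by rewrite divr_ge0 ?exprn_ge0.
by move: w; move: (_ * _ / n%:R) (_ / y%:R) => t s; lra.
Qed.

Lemma nsieve_sub_B_le (R : realType) k n y : (0 < n)%N -> (0 < y)%N ->
  (nsieve k.+3 (primorial y.+1) n)%:R * (k`!)%:R - (B k.+3 n)%:R * (k`!)%:R
    <= k.+3%:R ^+ 2 / y%:R * n%:R ^+ k.+2 :> R.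
Proof.
move=> n0 y0; rewrite lerBlDl.
have := nsieve_tail k y n0; rewrite -(ler_nat R) natrM => h; apply: le_trans h _.
rewrite natrD !natrM lerD2l natr_sum !natrX -mulrA -[leRHS]mulrA ler_wpM2l ?exprn_ge0 //.
have x0 : 0 < n%:R :> R by rewrite ltr0n.
apply: (@le_trans _ _ (n%:R ^+ k * (n%:R ^+ 2 * y%:R^-1))); last first.
  by rewrite mulrA -exprD addn2 [leRHS]mulrC.
rewrite ler_wpM2l ?exprn_ge0 //.
apply: le_trans (ler_wpM2l _ (sum_inv_sqr R n.+1 y0)); last by rewrite exprn_ge0.
rewrite mulr_sumr; apply: ler_sum_nat => p /andP[yp _].
have p0 : 0 < p%:R :> R by rewrite ltr0n (leq_ltn_trans _ yp).
rewrite natrX -expr_div_n lerXn2r ?nnegrE ?divr_ge0 //.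
by rewrite ler_pdivlMr // -natrM ler_nat leq_trunc_div.
Qed.

Lemma ln_le_scale (R : realType) n y : (0 < n)%N -> (n < 16 ^ (2 * y))%N ->
  ln (n%:R : R) <= 8 * y%:R.
Proof.
move=> n0 ny; have x0 : 0 < n%:R :> R by rewrite ltr0n.
rewrite -ler_expR lnK ?posrE //.
apply: (@le_trans _ _ ((16 ^ (2 * y))%:R)); first by rewrite ler_nat ltnW.
(* 16^(2y) = 2^(8y) <= e^(8y), since e >= 1 + 1. *)
rewrite -[16%N]/(2 ^ 4)%N -expnM mulnA -[8 * _]mulr1 -[8]/(8%:R) -natrM expRM_natl natrX.
rewrite lerXn2r ?nnegrE ?expR_ge0 //.
by have := expR_ge1Dx (1 : R).
Qed.

Lemma theorem4_ge3 (R : realType) (k n : nat) :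
  expR (k.+3%:R * 2 ^+ (k.+3 + 2) : R) <= n%:R ->
  `|(B k.+3 n)%:R - D R k.+3 * g R k.+3 n * (n%:R ^+ k.+2 / (k.+2)`!%:R)|
    <= 707 * n%:R ^+ k.+2 / ln (n%:R : R).
Proof.
move=> hn; have x0 : 0 < n%:R :> R by apply: lt_le_trans hn; exact: expR_gt0.
have n0 : (0 < n)%N by rewrite -(ltr0n R).
have hl : k.+3%:R * 2 ^+ (k.+3 + 2) <= ln (n%:R : R) by rewrite -ler_expR lnK ?posrE.
have n16 : (16 <= n)%N.
  rewrite -(ler_nat R); apply: le_trans hn; apply: le_trans (expR_ge1Dx _).
  rewrite -natrX -natrM -[1]/(1%:R) -natrD ler_nat.
  by have := ltn_expl k (isT : (1 < 2)%N); rewrite !addSn !expnS; nia.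
have [j /andP[yn ny]] := exists_scale n16; set y := (2 ^ j)%N in yn.
have y0 : (0 < y)%N by rewrite expn_gt0.
have ly : ln (n%:R : R) <= 8 * y%:R by apply: ln_le_scale => //; rewrite -expnS.
(* The lower bound on [n] gives (k+3) 2^(k+5) <= log n <= 8y. *)
have ky : (k.+2 <= y)%N.
  have : k.+3%:R * 2 ^+ (k.+3 + 2) <= 8 * y%:R :> R := le_trans hl ly.
  rewrite -natrX -!natrM ler_nat.
  by have := ltn_expl k (isT : (1 < 2)%N); rewrite !addSn !expnS; nia.
have l0 : 0 < ln (n%:R : R).
  by apply: lt_le_trans hl; rewrite mulr_gt0 ?exprn_gt0.
have y0R : 0 < y%:R :> R by rewrite ltr0n.
have e1 := nsieve_asymptotic R ky yn.
have e2 := nsieve_sub_B_le R k n0 y0.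
have e3 := B_le_nsieve k.+3 (primorial y.+1) n0.
have e4 := singular_series_bounds R (isT : (2 < k.+3)%N) n0 y0.
have X0 : 0 <= n%:R ^+ k.+2 :> R by rewrite exprn_ge0 // ltW.
have fk0 : 0 < (k`!)%:R :> R by rewrite ltr0n fact_gt0.
have fb0 : 0 < ((k.+2)`!)%:R :> R by rewrite ltr0n fact_gt0.
have sq : (k.+3 ^ 2 <= 16 * k`!)%N := sqr_le_fact k.
have sqk : k.+3%:R ^+ 2 <= 16 * (k`!)%:R :> R by rewrite -natrX -natrM ler_nat.
have fkb : (k`!)%:R <= ((k.+2)`!)%:R :> R by rewrite ler_nat !factS mulnA leq_pmull.
have sqb : k.+2%:R ^+ 2 <= k.+3%:R ^+ 2 :> R by rewrite lerXn2r ?nnegrE // ler_nat.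
set X := n%:R ^+ k.+2 in e1 e2 X0 *; set N := nsieve _ _ _ in e1 e2 e3.
set F := sieve_density _ _ _ _ in e1 e4; set DG := D R k.+3 * _ in e4 *.
(* An opaque unit of error, so that linear arithmetic can add the three contributions. *)
have [E EE] : exists E, E = X / y%:R by exists (X / y%:R).
have E0 : 0 <= E by rewrite EE divr_ge0 // ltW.
clearbody X F DG.
(* Sieve error: 2(k+2)^2 <= 2(k+3)^2 <= 32 k! <= 32 (k+2)!. *)
have d1 : `|(N%:R : R) - F * (X / ((k.+2)`!)%:R)| <= 32 * E.
  rewrite -(ler_pM2r fb0) -[X in _ * X <= _](gtr0_norm fb0) -normrM mulrBl -!mulrA mulVf ?gt_eqF // mulr1.
  apply: le_trans e1 _.
  have -> : 2 * k.+2%:R ^+ 2 / y%:R * X = 2 * k.+2%:R ^+ 2 * E by rewrite EE mulrAC mulrA.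
  by rewrite [E * _]mulrC [leRHS]mulrA ler_wpM2r //; lra.
(* Large primes: (k+3)^2 <= 16 k!. *)
have d2 : `|(B k.+3 n)%:R - (N%:R : R)| <= 16 * E.
  rewrite distrC ger0_norm ?subr_ge0 ?ler_nat // -(ler_pM2r fk0) mulrBl.
  apply: le_trans e2 _; rewrite mulrAC -mulrA -EE [leRHS]mulrAC ler_wpM2r //.
(* Truncated product: (k+3)^2 <= 16 k! <= 16 (k+2)!. *)
have d3 : `|F * (X / ((k.+2)`!)%:R) - DG * (X / ((k.+2)`!)%:R)| <= 16 * E.
  have /andP[lo hi] := e4.
  rewrite -mulrBl normrM ger0_norm ?subr_ge0 // ger0_norm ?divr_ge0 ?(ltW fb0) //.
  apply: (@le_trans _ _ (k.+3%:R ^+ 2 / y%:R * (X / ((k.+2)`!)%:R))).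
    by rewrite ler_wpM2r ?divr_ge0 ?(ltW fb0) // lerBlDl -lerBlDr.
  rewrite mulrA ler_pdivrMr // -mulrA [_^-1 * X]mulrC -EE [leRHS]mulrAC ler_wpM2r //; lra.
apply: (@le_trans _ _ (64 * E)).
  have -> : (B k.+3 n)%:R - DG * (X / ((k.+2)`!)%:R) = ((B k.+3 n)%:R - N%:R)
    + ((N%:R - F * (X / ((k.+2)`!)%:R)) + (F * (X / ((k.+2)`!)%:R) - DG * (X / ((k.+2)`!)%:R))).
    by rewrite addrACA -!addrA; ring.
  apply: le_trans (ler_normD _ _) _; have := ler_normD (N%:R - F * (X / ((k.+2)`!)%:R))
    (F * (X / ((k.+2)`!)%:R) - DG * (X / ((k.+2)`!)%:R)); lra.
(* Here log n <= 8y turns 64 into 512, below 707. *)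
rewrite ler_pdivlMr // EE mulrA mulrAC ler_pdivrMr //.
have : 64 * X * ln (n%:R : R) <= 64 * X * (8 * y%:R).
  by rewrite ler_wpM2l // mulr_ge0.
have : 0 <= X * y%:R by rewrite mulr_ge0.
by lra.
Qed.

(** * The case k = 2 *)

Local Open Scope nat_scope.

(** The second entry is n - x, and gcd(x, n - x) = gcd(x, n). *)
Lemma B2_totient n : 1 < n -> B 2 n = totient n.
Proof.
move=> n1; have n0 := ltnW n1; rewrite B_shift // (sum_ffun_insert ord0).
transitivity (\sum_(x < n) coprime n x.+1 * (x.+1 < n)).
  apply: eq_bigr => x _; rewrite (sum_ffun_insert ord0).
  transitivity (\sum_(y < n) (((x.+1 + y.+1 == n) && coprime x.+1 y.+1) : nat)).
    apply: eq_bigr => y _; rewrite (eq_bigr (fun=> ((x.+1 + y.+1 == n) && coprime x.+1 y.+1) : nat)).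
      by rewrite sum_nat_const card_ffun !card_ord mul1n.
    move=> f _; congr nat_of_bool.
    rewrite !(sum_ffun_insert_ord _ _ _ (fun u : 'I_n => u.+1)) big_ord0 addn0; congr (_ && _).
    have e0 : ffun_insert ord0 x (ffun_insert ord0 y f) ord0 = x by rewrite ffun_insert_at.
    have e1 : ffun_insert ord0 x (ffun_insert ord0 y f) (lift ord0 ord0) = y by rewrite ffun_insert_lift ffun_insert_at.
    apply/forallP/idP => [/(_ ord0)/forallP/(_ (lift ord0 ord0))|cxy i].
      by rewrite e0 e1.
    apply/forallP => j; case: (unliftP ord0 i) => [i' ->|->]; case: (unliftP ord0 j) => [j' ->|->];
      rewrite ?(ord1 i') ?(ord1 j') ?e0 ?e1 ?eqxx ?cxy ?implybT //.
    by rewrite coprime_sym cxy implybT.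
  have [lt_xn|le_nx] := ltnP x.+1 n; last first.
    by rewrite muln0 big1 // => y _; apply/eqP; rewrite eqb0; lia.
  (* The index [n - x.+2] encodes the entry [n - x.+1]. *)
  have yb : n - x.+2 < n by lia.
  rewrite muln1 (bigD1 (Ordinal yb)) //= big1 => [|y ny].
    have e : x.+1 + (n - x.+2).+1 = n by lia.
    have ec : gcdn n x.+1 = gcdn x.+1 (n - x.+2).+1 by rewrite -[X in gcdn X _]e gcdnC gcdnDl.
    by rewrite [X in X == _]e eqxx addn0 /coprime ec.
  apply/eqP; rewrite eqb0; apply: contra ny => /andP[/eqP e _].
  by apply/eqP/val_inj => /=; lia.
rewrite totient_count_coprime; case: n n1 {n0} => // n n1.
(* The ranges differ at their ends: the factor removes [x.+1 = n], and 0 is not coprime to n > 1. *)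
rewrite big_ord_recr /= ltnn muln0 addn0 big_mkord big_ord_recl.
rewrite [coprime _ _]/coprime gcdn0 gtn_eqF // add0n; apply: eq_bigr => x _ /=.
by rewrite ltnS ltn_ord muln1.
Qed.

Local Open Scope ring_scope.

Lemma totient_prod (R : realType) n : (0 < n)%N ->
  (totient n)%:R = n%:R * \prod_(p <- primes n) (1 - p%:R^-1) :> R.
Proof.
move=> n0; rewrite totientE // {3}(prod_prime_decomp n0) prime_decompE big_map /=.
rewrite !natr_prod -big_split /= big_seq [RHS]big_seq; apply: eq_bigr => p.
rewrite -logn_gt0 => lp; have pp : prime p by move: lp; rewrite lognE; case: prime.
have p0 : p%:R != 0 :> R by rewrite pnatr_eq0 -lt0n prime_gt0.
rewrite -{2}(prednK lp) natrM !natrX exprS mulrAC mulrBr mulr1 mulfV //; congr (_ * _).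
by rewrite -{2}(prednK (prime_gt0 pp)) -natr1 addrK.
Qed.

Lemma delta2 (R : realType) p : (0 < p)%N -> delta 2 (p%:R : R) = p%:R.
Proof.
move=> p0; have p0R : p%:R != 0 :> R by rewrite pnatr_eq0 -lt0n.
by rewrite /delta /= !expr2 expr1; field.
Qed.

(** Every factor of D_2 is 1, and g_2(n) is Euler's product for phi(n)/n. *)
Lemma main_term2 (R : realType) n : (0 < n)%N ->
  D R 2 * g R 2 n * (n%:R ^+ 1 / 1`!%:R) = (totient n)%:R.
Proof.
move=> n0; have -> : D R 2 = 1.
  rewrite /D (_ : (fun N : nat => _) = fun=> 1); first exact: lim_cst.
  apply/funext => N; apply: big1 => p pp.
  by rewrite delta2 ?prime_gt0 // expr1 divff // pnatr_eq0 -lt0n prime_gt0.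
rewrite mul1r expr1 divr1 mulrC totient_prod //; congr (_ * _).
rewrite /g big_seq [RHS]big_seq; apply: eq_bigr => p; rewrite mem_primes => /and3P[pp _ _].
by rewrite delta2 ?prime_gt0 // expr1 (_ : 2%:R - 1 = 1) ?mulr1 ?mulN1r; last by lra.
Qed.

Theorem theorem4 (R : realType) (k n : nat) :
  (2 <= k)%N ->
  expR (k%:R * 2 ^+ (k + 2) : R) <= n%:R ->
  `|(B k n)%:R - D R k * g R k n * (n%:R ^+ k.-1 / (k.-1)`!%:R)|
    <= 707 * n%:R ^+ k.-1 / ln (n%:R : R).
Proof.
case: k => [|[|[|k]]] // _ hn; last exact: theorem4_ge3.
have n1 : (1 < n)%N.
  rewrite -(ltr_nat R); apply: lt_le_trans hn; rewrite -[1%:R]expR0 ltr_expR.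
  by rewrite mulr_gt0 ?exprn_gt0.
(* The difference vanishes, leaving only the nonnegativity of the right side. *)
rewrite B2_totient // main_term2 ?(ltnW n1) // subrr normr0.
apply: divr_ge0; last by apply: ln_ge0; rewrite ler1n (ltnW n1).
by apply: mulr_ge0; [exact: ler0n | apply: exprn_ge0; exact: ler0n].
Qed.
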